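(* Let $Q$ be a nonzero quadratic form on $\mathbb{F}_{q_1}/\mathbb{F}_q$ with rank $r_Q$, and let \[\mathcal{C}_Q=\{(aQ(x)+\mathrm{Tr}_{q_2/q}(by))_{(x,y)\in\mathbb{F}^\star} : (a,b)\in\mathbb{F}_q\times\mathbb{F}_{q_2}\}.\] For each $r$ with $1\le r\le m_2+1$: (1) if $r_Q$ is even and $\epsilon=1$, then $d_r(\mathcal{C}_Q)=q^{M-r}\bigl(q^r-1-(q-1)q^{-r_Q/2}\bigr)$; (2) if $r_Q$ is even and $\epsilon=-1$, then $d_r(\mathcal{C}_Q)=q^{M-r}(q^r-1)$ for $1\le r<m_2+1$, and $d_r(\mathcal{C}_Q)=q^{M-r}\bigl(q^r-1+(q-1)q^{-r_Q/2}\bigr)$ for $r=m_2+1$; (3) if $r_Q$ is odd, then $d_r(\mathcal{C}_Q)=q^{M-r}(q^r-1)$.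
   Context: Let $p$ be an odd prime, $m\ge1$, $q=p^m$. Let $m_1,m_2$ be positive integers, $M=m_1+m_2$, $q_i=q^{m_i}$, $\mathbb{F}=\mathbb{F}_{q_1}\times\mathbb{F}_{q_2}$, $\mathbb{F}^\star=\mathbb{F}\setminus\{(0,0)\}$. $\mathrm{Tr}_{q^s/q}$ is the trace $\mathbb{F}_{q^s}\to\mathbb{F}_q$; $\eta$ is the quadratic character of $\mathbb{F}_q$ with $\eta(0)=0$. A quadratic form $Q$ on $\mathbb{F}_{q_1}/\mathbb{F}_q$ is a map $Q:\mathbb{F}_{q_1}\to\mathbb{F}_q$ with $Q(ax)=a^2Q(x)$ ($a\in\mathbb{F}_q$) such that $B_Q(x,y)=\frac12(Q(x+y)-Q(x)-Q(y))$ is $\mathbb{F}_q$-bilinear; its rank is $r_Q=m_1-\dim_{\mathbb{F}_q}\{x:B_Q(x,y)=0\ \forall y\}$. In suitable coordinates $Q=\sum_{i=1}^{r_Q}\lambda_ix_i^2$ with $\lambda_i\in\mathbb{F}_q^*$; $\varepsilon_Q=\eta(\lambda_1\cdots\lambda_{r_Q})$. Set $\epsilon=\varepsilon_Q(-1)^{(p-1)mr_Q/4}$ if $r_Q$ is even, $\epsilon=\varepsilon_Q(-1)^{(p-1)m(r_Q+1)/4}$ if $r_Q$ is odd. For a linear code $\mathcal{C}\subseteq\mathbb{F}_q^n$ of dimension $k$ and $1\le r\le k$, the $r$-th generalized Hamming weight is $d_r(\mathcal{C})=\min\{\#\mathrm{Supp}(K)\}$ over $r$-dimensional subspaces $K$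 of $\mathcal{C}$, where $\mathrm{Supp}(K)$ is the set of coordinates $i$ such that $c_i\neq0$ for some $c\in K$. *)

(* Defs.v *)
From HB Require Import structures.
From mathcomp Require Import all_boot all_order all_algebra.
From mathcomp Require Import fieldext finfield.
Set Implicit Arguments. Unset Strict Implicit. Unset Printing Implicit Defensive.
Import Order.TTheory GRing.Theory Num.Theory.
Local Open Scope ring_scope.

Definition eta (F : finFieldType) (a : F) : int :=
  if a == 0 then 0 else if [exists x : F, x ^+ 2 == a] then 1 else -1.

Definition bform (F : fieldType) (V : lmodType F) (Q : V -> F) (x y : V) : F :=
  (Q (x + y) - Q x - Q y) / 2%:R.

Definition is_quad_form (F : fieldType) (V : lmodType F) (Q : V -> F) : Prop :=
  (forall (a : F) (x : V), Q (a *: x) = a ^+ 2 * Q x) /\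
  (forall (a : F) (x1 x2 y : V),
      bform Q (a *: x1 + x2) y = a * bform Q x1 y + bform Q x2 y) /\
  (forall (a : F) (x y1 y2 : V),
      bform Q x (a *: y1 + y2) = a * bform Q x y1 + bform Q x y2).

Definition qf_radical (F : finFieldType) (K : fieldExtType F) (Q : K -> F) : seq K :=
  map (fun x : finvect_type K => x : K)
    (enum [pred x : finvect_type K | [forall y : finvect_type K, bform Q x y == 0]]).

Definition qf_rank (F : finFieldType) (K : fieldExtType F) (Q : K -> F) : nat :=
  (\dim {:K} - \dim <<qf_radical Q>>)%N.

Definition qf_diag_eps (F : finFieldType) (K : fieldExtType F) (Q : K -> F)
    (r : nat) (e : int) : Prop :=
  exists (b : (\dim {:K}).-tuple K) (lam : 'I_(\dim {:K}) -> F),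
    [/\ basis_of fullv b,
        (forall c : 'I_(\dim {:K}) -> F,
            Q (\sum_i c i *: b`_i) = \sum_(i < \dim {:K} | (i < r)%N) lam i * c i ^+ 2),
        (forall i : 'I_(\dim {:K}), (i < r)%N -> lam i != 0) &
        e = eta (\prod_(i < \dim {:K} | (i < r)%N) lam i)].

Definition qf_epsilon_is (p m : nat) (F : finFieldType) (K : fieldExtType F)
    (Q : K -> F) (eps : int) : Prop :=
  let r := qf_rank Q in
  exists e : int, qf_diag_eps Q r e /\
    eps = e * (-1) ^+ (((p - 1) * m * (if odd r then r.+1 else r)) %/ 4)%N.

(* absolute trace Tr_{K/F}(z) = sum_{i < [K:F]} z^(|F|^i), seen as an element of F *)
Definition fld_trace (F : finFieldType) (K : fieldExtType F) (z : K) : F :=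
  coord [tuple (1 : K)] ord0 (\sum_(i < \dim {:K}) z ^+ (#|F| ^ i)%N).

Definition coord_set (F : finFieldType) (K1 K2 : fieldExtType F) : predArgType :=
  {xy : finvect_type K1 * finvect_type K2 | xy != (0, 0)}.

Definition code_len (F : finFieldType) (K1 K2 : fieldExtType F) : nat :=
  #|coord_set K1 K2|.

Definition codeword (F : finFieldType) (K1 K2 : fieldExtType F) (Q : K1 -> F)
    (a : F) (b : K2) : 'rV[F]_(code_len K1 K2) :=
  \row_(j < code_len K1 K2)
     let xy := val (@enum_val (coord_set K1 K2) (mem (coord_set K1 K2)) j) in
     a * Q xy.1 + fld_trace (b * xy.2).

(* C_Q = { codeword a b : (a,b) in F_q x F_{q2} } (a linear subspace) *)
Definition code_CQ (F : finFieldType) (K1 K2 : fieldExtType F) (Q : K1 -> F)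
    : {vspace 'rV[F]_(code_len K1 K2)} :=
  <<[seq codeword Q a (b : K2) | a <- enum F, b <- enum (finvect_type K2)]>>%VS.

Definition supp (F : finFieldType) (n : nat) (K : {vspace 'rV[F]_n}) : {set 'I_n} :=
  [set i | [exists v : 'rV[F]_n, (v \in K) && (v 0 i != 0)]].

Definition is_ghw (F : finFieldType) (n : nat) (C : {vspace 'rV[F]_n}) (r d : nat) : Prop :=
  (exists K : {vspace 'rV[F]_n}, [/\ (K <= C)%VS, \dim K = r & #|supp K| = d]) /\
  (forall K : {vspace 'rV[F]_n}, (K <= C)%VS -> \dim K = r -> (d <= #|supp K|)%N).

(* Main.v *)
(* A subcode of dimension r is the image of an r-dimensional subspace H of
   F x K2, and its support misses exactly the nonzero common zeros (x, y) of the
   functions a Q(x) + Tr(b y), (a, b) in H; so d_r = q^M - max_H #zeros(H).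
   If (1, 0) is in H, then H = F x P with dim P = r - 1, the zeros form a product
   and their number is #{Q = 0} q^(m2 - r + 1).  Otherwise H is a graph over a
   subspace P of K2 of dimension r <= m2: for each x the admissible y form a coset
   of the trace annihilator of P, or the empty set, whence at most q^(M - r) zeros,
   with equality for H = 0 x P.  The number of zeros of Q is found by
   diagonalizing Q and adding one variable at a time; the step from odd to even
   rank is the Jacobi sum of the quadratic character with itself. *)
From HB Require Import structures.
Require Import Defs.
From mathcomp Require Import all_boot all_order all_algebra.
From mathcomp Require Import cyclic falgebra fieldext finfield ring zify.
Set Implicit Arguments. Unset Strict Implicit. Unset Printing Implicit Defensive.
Import Order.TTheory GRing.Theory Num.Theory.
Local Open Scope ring_scope.

(** * The quadratic character *)

Lemma pchar_nat_card (F : finFieldType) : [pchar F].-nat #|F|.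
Proof.
have [p pr_p pF] := finPcharP F.
rewrite (eq_pnat _ (pcharf_eq pF)).
have -> : #|F| = (p ^ logn p #|F|)%N by exact: (card_pprimeChar pF).
by rewrite pnatX pnat_id.
Qed.

Section QuadraticCharacter.

Variable F : finFieldType.
Hypothesis two_neq0 : (2%:R : F) != 0.
Local Notation q := (#|F|%:R : int).

Lemma eta0 : eta (0 : F) = 0.
Proof. by rewrite /eta eqxx. Qed.

Lemma eta_sqr (b : F) : b != 0 -> eta (b ^+ 2) = 1.
Proof.
move=> b0; rewrite /eta expf_eq0 (negbTE b0) /=.
by case: existsP => // -[]; exists b.
Qed.

(** A nonzero square [d ^+ 2] has exactly the roots [d] and [- d], distinct because [2] is
    invertible. *)
Lemma eta_sum_roots (a : F) : \sum_c (c ^+ 2 == a)%:R = 1 + eta a :> int.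
Proof.
rewrite /eta; case: (eqVneq a 0) => [->|a0].
  by rewrite (bigD1 0) //= expr0n eqxx big1 // => c c0; rewrite expf_eq0 (negbTE c0).
case: existsP => [[d /eqP dE]|nosq]; last first.
  by rewrite big1 // => c _; case: eqP => // ca; case: nosq; exists c; apply/eqP.
have d0 : d != 0 by apply: contraNneq a0 => d0; rewrite -dE d0 expr0n.
have dd : - d != d.
  rewrite -subr_eq0 -opprD oppr_eq0 -mulr2n -mulr_natr mulf_eq0 negb_or d0.
  exact: two_neq0.
rewrite (bigD1 d) //= (bigD1 (- d)) //= sqrrN dE eqxx big1 // => c /andP[c1 c2].
by rewrite -dE eqf_sqr (negbTE c1) (negbTE c2).
Qed.

(** The pairs [(a, c)] with [c ^+ 2 = a] are counted twice: by [c] there are [q], by [a] there are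
    [q] plus this sum. *)
Lemma sum_eta : \sum_(a : F) eta a = 0.
Proof.
have : \sum_(a : F) \sum_c (c ^+ 2 == a)%:R = q.
  rewrite exchange_big /= -sum1_card natr_sum; apply: eq_bigr => c _.
  by rewrite (bigD1 (c ^+ 2)) //= eqxx big1 // => a; rewrite eq_sym => /negbTE->.
rewrite (eq_bigr (fun a : F => 1 + eta a)) => [|a _]; last exact: eta_sum_roots.
rewrite big_split /= sumr_const => /(congr1 (fun x => x - q)).
by rewrite (addrC q) addrK subrr.
Qed.

Lemma eta_mul_sqr (a b : F) : b != 0 -> eta (a * b ^+ 2) = eta a.
Proof.
move=> b0; rewrite /eta mulf_eq0 expf_eq0 /= (negbTE b0) orbF.
case: eqP => // _; congr (if _ then _ else _).
apply/existsP/existsP => -[x /eqP xE].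
  exists (x / b); rewrite expr_div_n xE mulfK //.
  by rewrite expf_eq0.
by exists (x * b); rewrite exprMn xE.
Qed.

Lemma sum_eta_affine (a b : F) : a != 0 -> \sum_c eta (a * c + b) = 0.
Proof.
move=> a0; rewrite -[RHS]sum_eta [RHS](reindex_inj (addIr b)) /=.
by rewrite [RHS](reindex_inj (mulfI a0)).
Qed.

(* If [a] is a nonsquare, no term of [\sum_x (eta (a * x) + eta x)] is positive,
   while the sum vanishes; hence each term vanishes. *)
Lemma etaM (a b : F) : eta (a * b) = eta a * eta b.
Proof.
have [->|a0] := eqVneq a 0; first by rewrite mul0r eta0 mul0r.
have sqE x y : [exists z : F, z ^+ 2 == x] -> x != 0 -> eta (x * y) = eta x * eta y.
  case/existsP=> z /eqP <-; rewrite expf_eq0 /= => z0.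
  by rewrite mulrC eta_mul_sqr // eta_sqr // mul1r.
have [sqa|nsqa] := boolP [exists z : F, z ^+ 2 == a]; first exact: sqE.
have etaa : eta a = -1 by rewrite /eta (negbTE a0) (negbTE nsqa).
have le0 (x : F) : true -> 0 <= - (eta (a * x) + eta x).
  move=> _; have [->|x0] := eqVneq x 0; first by rewrite mulr0 eta0.
  have [sqx|nsqx] := boolP [exists z : F, z ^+ 2 == x].
    by rewrite mulrC sqE // etaa mulrN1 addrC subrr.
  rewrite {2}/eta (negbTE x0) (negbTE nsqx) /eta.
  by case: ifP => // _; case: ifP.
have /eqP : \sum_(x : F) - (eta (a * x) + eta x) = 0.
  rewrite sumrN big_split /= sum_eta addr0.
  rewrite (eq_bigr (fun x => eta (a * x + 0))) => [|x _]; last by rewrite addr0.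
  by rewrite sum_eta_affine ?oppr0.
rewrite psumr_eq0 // => /allP/(_ b (mem_index_enum _)) /=.
by rewrite oppr_eq0 addr_eq0 etaa mulN1r => /eqP.
Qed.

(** Substituting [c^-1] for [c] turns the summand into [eta ((a * c - 1) / c ^+ 2) = eta (a * c -
    1)]. What remains is an affine sum without its term at [c = 0], which is [eta (-1)]. *)
Lemma sum_eta_convolution (a : F) :
  \sum_c eta (c * (a - c)) = eta (-1 : F) * (q * (a == 0)%:R - 1).
Proof.
have -> : \sum_c eta (c * (a - c)) = \sum_(c | c != 0) eta (a * c - 1).
  rewrite (bigD1 0) //= mul0r eta0 add0r.
  rewrite (reindex_inj invr_inj) /=.
  apply: eq_big => [c|c]; rewrite invr_eq0 // => c0.
  rewrite -(@eta_mul_sqr (a * c - 1) c^-1) ?invr_eq0 //; congr eta.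
  by field.
have -> : \sum_(c | c != 0) eta (a * c - 1) = \sum_c eta (a * c - 1) - eta (-1 : F).
  by rewrite [in RHS](bigD1 0) //= mulr0 add0r addrAC subrr add0r.
have [->|a0] := eqVneq a 0; last by rewrite sum_eta_affine // mulr0 sub0r mulrN1.
under eq_bigr do rewrite mul0r add0r.
by rewrite sumr_const -mulr_natr cardT -cardE /=; ring.
Qed.

Lemma odd_card_finField : odd #|F|.
Proof.
rewrite odd_2'nat; apply: sub_in_pnat (pchar_nat_card F) => p _ pF.
by apply: contraNneq two_neq0 => p2; rewrite -p2 (pcharf0 pF).
Qed.

(** Let [n = q - 1]. If [n./2] is odd, a square root of [-1] raised to the power [n] would give
    [1 = -1]. If it is even, a generator [g] has [g ^+ n./2 = -1], and [g ^+ n./2./2] is a root. *)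
Lemma eta_N1 : eta (-1 : F) = (-1) ^+ (#|F|.-1./2).
Proof.
set n := #|F|.-1.
have n_gt0 : (0 < n)%N by rewrite /n -ltnS prednK ?finNzRing_gt1 // ltnW ?finNzRing_gt1.
have nE : n = n./2.*2.
  rewrite -[LHS]odd_double_half (_ : odd n = false) // /n.
  by case: #|F| odd_card_finField => //= k /negbTE.
have X1 (x : F) : x != 0 -> x ^+ n = 1.
  move=> x0; apply: (mulfI x0); rewrite -exprS /n prednK ?expf_card ?mulr1 //.
  by rewrite ltnW ?finNzRing_gt1.
have N1 : (-1 : F) != 1.
  by rewrite -subr_eq0 -opprD oppr_eq0.
have N0 : (-1 : F) != 0 by rewrite oppr_eq0 oner_eq0.
rewrite -signr_odd /eta (negbTE N0).
have [o|e] := boolP (odd n./2).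
  case: existsP => // -[i /eqP i2].
  have i0 : i != 0 by apply: contraNneq N0 => i0; rewrite -i2 i0 expr0n.
  have := X1 i i0; rewrite nE -muln2 mulnC exprM i2 -[_ ^+ n./2]signr_odd o expr1.
  by move/eqP/negPn; rewrite N1.
have [g _ pg] : exists2 g, g \in enum [pred x : F | x != 0] & n.-primitive_root g.
  apply/hasP; apply: has_prim_root => //; last first.
  - by rewrite -cardE cardC1.
  - exact: enum_uniq.
  by apply/allP => x; rewrite mem_enum => x0; apply/unity_rootP; apply: X1.
(* Its square is [1], and it is not [1] because [g] has order [n > n./2]. *)
have : g ^+ n./2 = -1.
  have : (g ^+ n./2) ^+ 2 == 1 ^+ 2.
    by rewrite -exprM muln2 -nE (prim_expr_order pg) expr1n.
  rewrite eqf_sqr => /orP[|/eqP //]; rewrite -(prim_order_dvd pg) => /dvdn_leq.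
  rewrite half_gt0; lia.
rewrite -[n./2]odd_double_half (negbTE e) -muln2 exprM => gE.
by case: existsP => // -[]; exists (g ^+ n./2./2); rewrite gE.
Qed.

End QuadraticCharacter.

(** * Diagonal equations *)

Section DiagonalCount.

Variable F : finFieldType.
Hypothesis two_neq0 : (2%:R : F) != 0.
Local Notation q := (#|F|%:R : int).

(** Number of solutions of the diagonal equation with coefficients [s] and right-hand side [a]; zero
    coefficients are allowed. *)
Fixpoint dcount (s : seq F) (a : F) : int :=
  if s is l :: s' then \sum_c dcount s' (a - l * c ^+ 2) else (a == 0)%:R.

Lemma sum_ffunS n (f : {ffun 'I_n.+1 -> F} -> int) :
  \sum_c f c =
  \sum_(c : F) \sum_(g : {ffun 'I_n -> F})
     f [ffun i => if unlift ord0 i is Some j then g j else c].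
Proof.
rewrite pair_big /=.
rewrite (reindex (fun u : F * {ffun 'I_n -> F} =>
  [ffun i => if unlift ord0 i is Some j then u.2 j else u.1])) //=.
exists (fun c : {ffun 'I_n.+1 -> F} => (c ord0, [ffun j => c (lift ord0 j)])).
  case=> c g _ /=; congr (_, _); first by rewrite ffunE unlift_none.
  by apply/ffunP => j; rewrite !ffunE liftK.
move=> c _; apply/ffunP => i; rewrite ffunE /=.
by case: unliftP => [j ->|->]; rewrite ?ffunE.
Qed.

Lemma dcountE n (lam : 'I_n -> F) (a : F) :
  \sum_(c : {ffun 'I_n -> F}) (\sum_i lam i * c i ^+ 2 == a)%:R
    = dcount [seq lam i | i <- enum 'I_n] a.
Proof.
elim: n lam a => [|n IH] lam a.
  rewrite enum_ord0 /= (big_pred1 [ffun=> 0]); last first.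
    by move=> c; apply/esym/eqP/ffunP => -[].
  by rewrite big_ord0 eq_sym.
rewrite enum_ordSl /= sum_ffunS; apply: eq_bigr => c _.
rewrite -map_comp -IH; apply: eq_bigr => g _; congr (nat_of_bool _)%:R.
rewrite big_ord_recl ffunE unlift_none -subr_eq0 -[in RHS]subr_eq0.
under eq_bigr do rewrite ffunE liftK.
by congr (_ == _); rewrite /=; ring.
Qed.

(* [q] times the number of solutions of a nondegenerate diagonal equation in [r]
   unknowns with coefficient product [P] and right-hand side [a]; the factor [q]
   keeps the case [r = 0] integral. *)
Definition dcount_value (r : nat) (P a : F) : int :=
  q ^+ r + if odd r then q ^+ (r./2).+1 * eta ((-1) ^+ r./2 * P * a)
           else q ^+ r./2 * eta ((-1) ^+ r./2 * P) * (q * (a == 0)%:R - 1).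

(** The equation [l * c ^+ 2 = d] amounts to [(l * c) ^+ 2 = l * d], which has [1 + eta (l * d)]
    solutions [c]. *)
Lemma sum_dcount_step (f : F -> int) (l a : F) : l != 0 ->
  \sum_c f (a - l * c ^+ 2) = \sum_d f (a - d) * (1 + eta (l * d)).
Proof.
move=> l0.
transitivity (\sum_c \sum_d f (a - d) * (l * c ^+ 2 == d)%:R).
  apply: eq_bigr => c _; rewrite (bigD1 (l * c ^+ 2)) //= eqxx mulr1.
  by rewrite big1 ?addr0 // => d; rewrite eq_sym => /negbTE->; rewrite mulr0.
rewrite exchange_big; apply: eq_bigr => d _ /=; rewrite -mulr_sumr.
congr (_ * _); rewrite -eta_sum_roots // [RHS](reindex_inj (mulfI l0)) /=.
apply: eq_bigr => c _; congr (nat_of_bool _)%:R.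
by rewrite -(inj_eq (mulfI l0)); congr (_ == _); ring.
Qed.

(** The main term is multiplied by the sum of [1 + eta (l * d)], which is [q]. For odd [r] the
    character term becomes a vanishing affine sum plus a Jacobi sum. For even [r] it becomes a
    multiple of [q * (1 + eta (l * a)) - q]. *)
Lemma dcount_value_step (r : nat) (P l a : F) : l != 0 ->
  \sum_c dcount_value r P (a - l * c ^+ 2) = dcount_value r.+1 (l * P) a.
Proof.
move=> l0; rewrite sum_dcount_step // /dcount_value.
have sum1 : \sum_(d : F) (1 + eta (l * d)) = q.
  rewrite big_split /= sumr_const.
  rewrite (eq_bigr (fun d => eta (l * d + 0))) => [|d _]; last by rewrite addr0.
  by rewrite sum_eta_affine // addr0.
have halfS := uphalf_half r.
under eq_bigr do rewrite mulrDl; rewrite /=.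
rewrite big_split /= -mulr_sumr sum1 halfS -exprSr; congr (_ + _).
have [o|e] := boolP (odd r); rewrite /=.
  transitivity (\sum_d q ^+ (r./2).+1 * eta ((-1) ^+ r./2 * P) *
      (eta (a - d) + eta l * eta (d * (a - d)))).
    by apply: eq_bigr => d _; rewrite !(etaM two_neq0); ring.
  rewrite -mulr_sumr big_split /= -mulr_sumr sum_eta_convolution //.
  rewrite (eq_bigr (fun d => eta (-1 * d + a))) => [|d _]; last by congr eta; ring.
  rewrite sum_eta_affine ?oppr_eq0 ?oner_eq0 // add0r add1n.
  rewrite [(-1) ^+ r./2.+1]exprS !(etaM two_neq0); ring.
transitivity (\sum_d q ^+ r./2 * eta ((-1) ^+ r./2 * P) *
   (q * ((a == d)%:R * (1 + eta (l * d))) - (1 + eta (l * d)))).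
  by apply: eq_bigr => d _; rewrite subr_eq0; ring.
rewrite -mulr_sumr sumrB -mulr_sumr sum1 (bigD1 a) //= eqxx mul1r.
rewrite big1 ?addr0 => [|d]; last by rewrite eq_sym => /negbTE->; rewrite mul0r.
rewrite add0n [q ^+ _.+1]exprS !(etaM two_neq0); ring.
Qed.

(** A zero coefficient leaves its unknown free, hence a factor [q]; a nonzero one is absorbed by
    [dcount_value_step]. On the empty list [dcount_value] is [1 + (q * (a == 0)%:R - 1)]. *)
Lemma dcount_formula (s : seq F) (a : F) :
  q * dcount s a = q ^+ count (pred1 0) s *
    dcount_value (count (predC1 0) s) (\prod_(l <- s | l != 0) l) a.
Proof.
elim: s a => [|l s IH] a /=.
  rewrite big_nil /dcount_value /= !expr0 !mul1r.
  by rewrite -[X in eta X](expr1n _ 2) eta_sqr ?oner_eq0 // mul1r addrC subrK.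
rewrite mulr_sumr big_cons; have [->|l0] /= := eqVneq l 0.
  under eq_bigr do rewrite mul0r subr0 IH.
  by rewrite sumr_const -[LHS]mulr_natl add0n add1n exprS -mulrA.
under eq_bigr do rewrite IH.
by rewrite -mulr_sumr dcount_value_step.
Qed.

End DiagonalCount.

(** * Diagonalization of quadratic forms *)

(** Gives access to kernels and images, as subspaces, of maps defined as plain functions. *)
Lemma linear_lfun (F : fieldType) (U V : vectType F) (f : U -> V) :
  linear f -> exists g : 'Hom(U, V), g =1 f.
Proof.
move=> lin_f.
pose f' : {linear U -> V} := HB.pack f (GRing.isLinear.Build F U V *:%R f lin_f).
by exists (linfun f') => x; rewrite lfunE.
Qed.

Section QuadraticForm.

Variables (F : fieldType) (V : vectType F) (Q : V -> F).
Hypothesis two_neq0 : (2%:R : F) != 0.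
Hypothesis quadQ : is_quad_form Q.
Local Notation B := (bform Q).

Lemma bformC x y : B x y = B y x.
Proof. by rewrite /bform (addrC x) -!addrA (addrC (- Q x)). Qed.

Lemma bform_diag x : B x x = Q x.
Proof.
have [QZ _] := quadQ.
rewrite /bform -mulr2n -scaler_nat QZ; field.
exact: two_neq0.
Qed.

Lemma bform_lfun x : exists g : 'Hom(V, F^o), forall y, g y = B x y.
Proof.
have [_ [_ Br]] := quadQ.
by apply: (@linear_lfun F V F^o (fun y => B x y)) => a u v; rewrite Br.
Qed.

Lemma bform_sumr (I : finType) x (c : I -> F) (v : I -> V) :
  B x (\sum_i c i *: v i) = \sum_i c i * B x (v i).
Proof.
have [g gE] := bform_lfun x; rewrite -gE linear_sum; apply: eq_bigr => i _.
by rewrite linearZ /= gE.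
Qed.

(** Gram-Schmidt by induction on the dimension: unless [B] vanishes on [U], some [x] with [Q x != 0]
    splits off, and the kernel of [B x] in [U] remains. *)
Lemma orthogonal_basis_exists (U : {vspace V}) :
  exists2 b, basis_of U b & pairwise (fun x y => B x y == 0) b.
Proof.
have [n] := ubnP (\dim U); elim: n U => // n IH U ltn.
have [B0|] := boolP (all2rel (fun x y => B x y == 0) (vbasis U)).
  exists (vbasis U); first exact: vbasisP.
  by apply/(pairwiseP 0) => i j li lj _; move/allrelP: B0; apply; apply: mem_nth.
move=> /allPn[u uU /allPn[v vU Buv]].
(* If [Q] vanishes at [u] and at [v], then [B u v != 0] forces [Q (u + v) != 0]. *)
have [x xU Qx0] : exists2 x, x \in U & Q x != 0.
  have [Qu0|?] := eqVneq (Q u) 0; last by exists u => //; apply: vbasis_mem.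
  have [Qv0|?] := eqVneq (Q v) 0; last by exists v => //; apply: vbasis_mem.
  exists (u + v); first by rewrite memvD ?vbasis_mem.
  by apply: contraNneq Buv => Quv; rewrite /bform Quv Qu0 Qv0 !subr0 mul0r.
have [g gE] := bform_lfun x.
have gx0 : g x != 0 by rewrite gE bform_diag.
have xU' : x \notin (U :&: lker g)%VS by rewrite memv_cap memv_ker (negbTE gx0) andbF.
have [|b /andP[/eqP spanb freeb] orthb] := IH (U :&: lker g)%VS.
  rewrite -ltnS; apply: leq_trans ltn; rewrite ltnS ltnNge.
  apply: contra xU' => le_dim.
  have /eqP-> // : (U :&: lker g == U)%VS by rewrite eqEdim capvSl.
exists (x :: b); last first.
  rewrite /= orthb andbT; apply/allP => y /memv_span; rewrite spanb memv_cap memv_ker.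
  by case/andP=> _; rewrite gE.
rewrite /basis_of free_cons spanb xU' freeb andbT span_cons spanb eqEsubv.
rewrite subv_add -memvE xU capvSl /= ; apply/andP; split=> //.
apply/subvP => y yU.
(* Subtracting the projection [g y / g x *: x] leaves a vector of [lker g]. *)
rewrite -[y](addrNK (g y / g x *: x)) addrC memv_add ?memvZ ?memv_line //.
rewrite memv_cap memv_ker memvB ?memvZ //= linearB linearZ /= subr_eq0.
by rewrite [_ *: _]divfK.
Qed.

Lemma diagonal_basis_exists :
  exists (b : (\dim {:V}).-tuple V) (lam : 'I_(\dim {:V}) -> F),
    basis_of fullv b /\
    forall c : 'I_(\dim {:V}) -> F,
      Q (\sum_i c i *: b`_i) = \sum_i lam i * c i ^+ 2.
Proof.
have [b basb orthb] := orthogonal_basis_exists fullv.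
have szb : size b == \dim {:V} by rewrite -(span_basis basb) eq_sym -/(free b) (basis_free basb).
exists (Tuple szb), (fun i => Q b`_i); split=> // c.
rewrite -bform_diag bform_sumr; apply: eq_bigr => i _ /=.
rewrite bformC bform_sumr (bigD1 i) //= big1 ?addr0 => [|j ij].
  by rewrite bform_diag; ring.
suff -> : B b`_i b`_j = 0 by rewrite mulr0.
have lt k : (k < \dim {:V})%N -> k \in gtn (size b) by rewrite inE (eqP szb).
have /pairwiseP orthP := orthb.
have [ltij|ltji|/val_inj eqij] := ltngtP i j; last by rewrite eqij eqxx in ij.
  by apply/eqP; apply: (orthP 0) => //; apply: lt.
by rewrite bformC; apply/eqP; apply: (orthP 0) => //; apply: lt.
Qed.

End QuadraticForm.

(** * Zero count and rank in diagonal coordinates *)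

Section DiagonalForm.

Variables (F : finFieldType) (K : fieldExtType F) (Q : K -> F).
Hypothesis two_neq0 : (2%:R : F) != 0.
Local Notation n := (\dim {:K}).
Local Notation q := (#|F|%:R : int).
Variables (b : n.-tuple K) (lam : 'I_n -> F).
Hypothesis basb : basis_of fullv b.
Hypothesis QE : forall c : 'I_n -> F, Q (\sum_i c i *: b`_i) = \sum_i lam i * c i ^+ 2.
Local Notation lams := [seq lam i | i <- enum 'I_n].

Let freeb : free b := basis_free basb.

Let coordE (x : K) : x = \sum_i coord b i x *: b`_i.
Proof. exact: coord_basis basb (memvf x). Qed.

Lemma card_diagonal_form (a : F) :
  (#|[set x : finvect_type K | Q x == a]|%:R : int) = dcount lams a.
Proof.
rewrite -dcountE -sum1_card natr_sum big_mkcond /=.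
rewrite (reindex (fun c : {ffun 'I_n -> F} => \sum_i c i *: b`_i : finvect_type K)) /=.
  by apply: eq_bigr => c _; rewrite inE QE; case: eqP.
exists (fun x => [ffun i => coord b i (x : K)]) => [c _|x _].
  by apply/ffunP => i; rewrite ffunE coord_sum_free.
by rewrite [RHS]coordE; apply: eq_bigr => i _; rewrite ffunE.
Qed.

Lemma bform_diagonal (c d : 'I_n -> F) :
  bform Q (\sum_i c i *: b`_i) (\sum_i d i *: b`_i) = \sum_i lam i * (c i * d i).
Proof.
rewrite /bform -big_split /=; under eq_bigr do rewrite -scalerDl.
rewrite !QE -!sumrB mulr_suml; apply: eq_bigr => i _; field.
exact: two_neq0.
Qed.

Lemma bform_basis (x : K) (j : 'I_n) : bform Q x (tnth b j) = lam j * coord b j x.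
Proof.
rewrite {1}[x]coordE [tnth b j]coordE bform_diagonal (tnth_nth 0).
rewrite (bigD1 j) //= coord_free // eqxx mulr1 big1 ?addr0 // => i ij.
by rewrite coord_free // eq_sym (negbTE ij) !mulr0.
Qed.

(** By [bform_basis] the radical is spanned by the basis vectors whose coefficient is zero. *)
Lemma qf_rank_diagonal : qf_rank Q = count (predC1 0) lams.
Proof.
have radE (x : K) : (x \in qf_radical Q) = [forall y : finvect_type K, bform Q x y == 0].
  apply/mapP/idP => [[y] | xP]; first by rewrite mem_enum inE => ? ->.
  by exists x; rewrite ?mem_enum ?inE.
pose s0 := [seq tnth b i | i <- enum 'I_n & lam i == 0].
pose s1 := [seq tnth b i | i <- enum 'I_n & lam i != 0].
(* [s1] completes [s0] to a permutation of the basis, so [s0] is free and its length is the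
   dimension of its span. *)
have perm_b : perm_eq (s0 ++ s1) b.
  rewrite -map_cat -[b in perm_eq _ b]map_tnth_enum.
  exact/perm_map/permPl/perm_filterC.
have free0 : free s0 by move: freeb; rewrite -(perm_free perm_b) => /catl_free.
rewrite /qf_rank; have -> : <<qf_radical Q>>%VS = <<s0>>%VS.
  apply/eqP; rewrite eqEsubv; apply/andP; split; apply/span_subvP => x.
    rewrite radE => /forallP radx; rewrite [x]coordE.
    apply: memv_suml => i _; rewrite -tnth_nth; have [l0|l0] := eqVneq (lam i) 0.
      rewrite memvZ // memv_span //; apply/mapP; exists i => //.
      by rewrite mem_filter l0 eqxx mem_enum.
    have := radx (tnth b i); rewrite bform_basis mulf_eq0 (negbTE l0) => /eqP->.
    by rewrite scale0r mem0v.
  case/mapP => i; rewrite mem_filter => /andP[/eqP li _] ->.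
  apply/memv_span; rewrite radE; apply/forallP => y.
  by rewrite bformC bform_basis li mul0r.
rewrite (eqP free0) size_map size_filter -(count_map lam (pred1 0)).
have := count_predC (pred1 0) lams; rewrite size_map size_enum_ord => {1}<-.
by rewrite addKn.
Qed.

End DiagonalForm.

(** * Number of zeros of a quadratic form *)

Section RootCount.

Variables (F : finFieldType) (K : fieldExtType F) (Q : K -> F).
Hypothesis two_neq0 : (2%:R : F) != 0.
Hypothesis quadQ : is_quad_form Q.
Local Notation n := (\dim {:K}).
Local Notation q := (#|F|%:R : int).
Local Notation Z := (#|[set x : finvect_type K | Q x == 0]|).
Local Notation r := (qf_rank Q).

(** At [a = 0] the character term of [dcount_value] contains [eta 0 = 0], so only the main term is
    left. *)
Lemma card_roots_odd_rank : odd r -> (Z * #|F| = #|F| ^ n)%N.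
Proof.
have [b [lam [basb QE]]] := diagonal_basis_exists two_neq0 quadQ.
have rE := qf_rank_diagonal two_neq0 basb QE.
move=> odd_r; apply/eqP; rewrite -(eqr_nat int) natrM natrX mulrC.
rewrite (card_diagonal_form basb QE) dcount_formula // /dcount_value -rE odd_r.
rewrite mulr0 eta0 mulr0 addr0 -exprD rE count_predC size_map -cardE.
by rewrite card_ord.
Qed.

Lemma qf_rank_le : (r <= n)%N.
Proof. exact: leq_subr. Qed.

(** The count is made in the coordinates that define [e], so that the coefficient product is the one
    inside [e]. *)
Lemma card_roots_even_rank (e : int) : ~~ odd r -> qf_diag_eps Q r e ->
  Z%:R * q = q ^+ (n - r) *
    (q ^+ r + q ^+ r./2 * (eta (-1 : F) ^+ r./2 * e) * (q - 1)).
Proof.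
move=> even_r [b [lam [basb QE lam0 ->]]].
(* [qf_diag_eps] leaves [lam i] arbitrary from index [r] on; zeros there turn the truncated sum into
   a full diagonal form. *)
pose lam' (i : 'I_n) := if (i < r)%N then lam i else 0.
have QE' (c : 'I_n -> F) : Q (\sum_i c i *: b`_i) = \sum_i lam' i * c i ^+ 2.
  rewrite QE big_mkcond; apply: eq_bigr => i _; rewrite /lam'.
  by case: ifP => // _; rewrite mul0r.
have lam'0 i : (lam' i != 0) = (i < r)%N.
  by rewrite /lam'; case: ifP => [/lam0//|_]; rewrite eqxx.
have rE := qf_rank_diagonal two_neq0 basb QE'.
rewrite mulrC (card_diagonal_form basb QE') dcount_formula // /dcount_value -rE.
rewrite (negbTE even_r) eqxx mulr1 etaM //.
have -> : count (pred1 0) [seq lam' i | i <- enum 'I_n] = (n - r)%N.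
  apply/eqP; rewrite -(eqn_add2r r) subnK ?qf_rank_le // {1}rE count_predC.
  by rewrite size_map -cardE card_ord.
have -> : eta ((-1) ^+ r./2 : F) = eta (-1 : F) ^+ r./2.
  elim: (r./2) => [|k IH]; last by rewrite !exprS etaM // IH.
  by rewrite !expr0 -[X in eta X](expr1n _ 2) eta_sqr ?oner_eq0.
rewrite big_map big_enum_cond /=.
congr (_ * (_ + _ * (_ * eta _) * _)); apply: eq_big => // i; rewrite lam'0 //.
by rewrite /lam' => ->.
Qed.

End RootCount.

(** Induction from [(2a + 1)(2b + 1) - 1 = 2(b + a(2b + 1))]. With [p = 2a + 1] it compares the
    exponent in [eta_N1] with [(p - 1) m / 2]. *)
Lemma odd_half_pred_exp (a m : nat) :
  odd ((a.*2.+1 ^ m).-1./2) = odd (a * m).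
Proof.
elim: m => [|m IH]; first by rewrite muln0.
have [b bE] : exists b, (a.*2.+1 ^ m = b.*2.+1)%N.
  exists (a.*2.+1 ^ m)./2; rewrite -[LHS]odd_double_half oddX /=.
  by rewrite odd_double orbT.
move: IH; rewrite bE /= doubleK => IH; rewrite expnS bE.
have -> : ((a.*2.+1 * b.*2.+1).-1 = (b + a * b.*2.+1).*2)%N.
  rewrite -!muln2; lia.
by rewrite doubleK oddD IH !oddM /= odd_double; case: (odd a); case: (odd m).
Qed.

(** By [eta_N1], [eta (-1) ^+ r./2] is exactly the sign that turns [e] into [eps]. *)
Lemma card_roots_epsilon (F : finFieldType) (K : fieldExtType F) (Q : K -> F)
    (p m : nat) (eps : int) (r := qf_rank Q) :
  (2%:R : F) != 0 -> odd p -> #|F| = (p ^ m)%N -> ~~ odd r -> qf_epsilon_is p m Q eps ->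
  #|[set x : finvect_type K | Q x == 0%R]|%:R * #|F|%:R =
    #|F|%:R ^+ (\dim {:K} - r) *
    (#|F|%:R ^+ r + #|F|%:R ^+ r./2 * eps * (#|F|%:R - 1)) :> int.
Proof.
move=> two0 odd_p cardF even_r [e [/(card_roots_even_rank two0 even_r) -> ->]].
rewrite (negbTE even_r) -/r; congr (_ * (_ + _ * _ * _)).
rewrite mulrC eta_N1 // cardF; congr (_ * _).
have rE : r = r./2.*2 by rewrite -[LHS]odd_double_half (negbTE even_r).
have pE : p = p./2.*2.+1 by rewrite -[LHS]odd_double_half odd_p.
rewrite -exprM -[LHS]signr_odd -[RHS]signr_odd {1}pE oddM odd_half_pred_exp -oddM.
congr (_ ^+ odd _).
rewrite [in RHS]pE [in RHS]rE subn1 /= -!muln2.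
(* The division by 4 in the exponent of [eps] is exact, since [p - 1] and [r] are even. *)
have -> : (p./2 * 2 * m * (r./2 * 2) = p./2 * m * r./2 * 4)%N by ring.
by rewrite mulnK.
Qed.

(** * The trace form *)

Section Trace.

Variables (F : finFieldType) (K : fieldExtType F).
Local Notation q := #|F|.
Local Notation n := (\dim {:K}).
Local Notation T := (@fld_trace F K).

Let tr (z : K) : K := \sum_(i < n) z ^+ (q ^ i)%N.

Lemma card_fieldExt : #|finvect_type K| = (q ^ n)%N.
Proof.
transitivity #|(fullv : {vspace finvect_type K})|; last exact: card_vspace.
by apply/esym/eq_card => x; rewrite memvf.
Qed.

Lemma exprD_card_pow (x y : K) i : (x + y) ^+ (q ^ i)%N = x ^+ (q ^ i)%N + y ^+ (q ^ i)%N.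
Proof.
by apply: exprDn_pchar; rewrite (eq_pnat _ (pchar_lalg K)) pnatX pchar_nat_card.
Qed.

Lemma scaler_card_pow (a : F) (x : K) i : (a *: x) ^+ (q ^ i)%N = a *: x ^+ (q ^ i)%N.
Proof.
rewrite exprZn; congr (_ *: _).
by elim: i => // i IH; rewrite expnSr exprM IH expf_card.
Qed.

Let tr_linear : linear tr.
Proof.
move=> a x y; rewrite /tr scaler_sumr -big_split /=.
by apply: eq_bigr => i _; rewrite exprD_card_pow scaler_card_pow.
Qed.

(** Raising to the power [q] permutes the terms cyclically, as [z ^+ (q ^ n) = z], and the elements
    fixed by this power form the line of [1]. *)
Let tr_mem1 z : tr z \in <[1 : K]>%VS.
Proof.
rewrite (Fermat's_little_theorem 1%AS) /order dimv1 expn1.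
have exprD : {morph (fun x : K => x ^+ q) : x y / x + y}.
  by move=> x y; have := exprD_card_pow x y 1; rewrite !expn1.
have expr0q : (0 : K) ^+ q = 0 by rewrite expr0n eqn0Ngt (ltnW (finNzRing_gt1 F)).
have zn : z ^+ (q ^ n)%N = z.
  by apply/eqP; rewrite -(Fermat's_little_theorem {:K}%AS) memvf.
have n_gt0 : (0 < n)%N := adim_gt0 {:K}%AS.
rewrite /tr (big_morph _ exprD expr0q) -(prednK n_gt0) [X in X == _]big_ord_recr /=.
rewrite big_ord_recl /= -[X in _ + X]exprM -expnSr prednK // zn addrC; apply/eqP; congr (_ + _).
by apply: eq_bigr => i _; rewrite -exprM -expnSr.
Qed.

Lemma fld_trace_linear : linear (T : K -> F^o).
Proof. by move=> a x y; rewrite /fld_trace -[\sum_(i < n) _]/(tr _) tr_linear linearP. Qed.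

(** The trace is given by a nonzero polynomial of degree at most [q ^ n.-1], too small to vanish at
    all [q ^ n] elements of [K]. *)
Lemma fld_trace_neq0 : exists z, T z != 0.
Proof.
have n_gt0 : (0 < n)%N := adim_gt0 {:K}%AS.
pose P : {poly K} := \sum_(i < n) 'X^(q ^ i).
have P_small : (size P <= (q ^ n.-1).+1)%N.
  apply: leq_trans (size_sum _ _ _) _; apply/bigmax_leqP => i _.
  rewrite size_polyXn ltnS leq_exp2l ?finNzRing_gt1 //.
  by rewrite -ltnS prednK.
have P_neq0 : P != 0.
  apply/eqP => /(congr1 (fun p : {poly K} => p`_1)).
  rewrite coef0 /P coef_sum (bigD1 (Ordinal n_gt0)) //= coefXn expn0 eqxx.
  rewrite big1 ?addr0 => [/eqP|i i0]; first by rewrite oner_eq0.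
  rewrite coefXn -[1%N](expn0 q) eqn_exp2l ?finNzRing_gt1 //.
  by case: eqP => // i1; case/eqP: i0; apply: val_inj.
pose s := [seq x : K | x <- enum (finvect_type K)].
have s_uniq : uniq s by rewrite map_inj_uniq //; exact: (enum_uniq (finvect_type K)).
have [/allP sP|] := boolP (all (root P) s).
  have := max_poly_roots P_neq0 (introT allP sP) s_uniq.
  rewrite size_map (_ : size _ = q ^ n)%N; last by rewrite -card_fieldExt cardE.
  move=> /leq_trans/(_ P_small).
  by rewrite ltnS leq_exp2l ?finNzRing_gt1 // -ltnS prednK // ltnn.
case/allPn => z _ rz; exists z; apply: contra rz => /eqP Tz.
rewrite rootE /P horner_sum; under eq_bigr do rewrite hornerXn.
(* As [tr z] lies on the line of [1], its coordinate [T z = 0] makes it zero. *)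
have := tr_mem1 z; rewrite -span_seq1 => /(@coord_span _ _ _ [tuple (1 : K)]).
by rewrite big_ord1 -[tr z]/(\sum_(i < n) _) [coord _ _ _]Tz scale0r => ->.
Qed.

End Trace.

(** * Annihilators under the trace form *)

Section TraceForm.

Variables (F : finFieldType) (K : fieldExtType F).
Local Notation n := (\dim {:K}).
Local Notation T := (@fld_trace F K).

Lemma fld_traceZ a (x : K) : T (a *: x) = a * T x.
Proof.
have := fld_trace_linear a x 0; rewrite addr0 => ->.
have := fld_trace_linear 1 (0 : K) 0.
rewrite scaler0 addr0 scale1r => /(congr1 (fun t : F => t - T 0)).
by rewrite subrr addrK => <-; rewrite addr0.
Qed.

Lemma fld_traceD (x y : K) : T (x + y) = T x + T y.
Proof. by have := fld_trace_linear 1 x y; rewrite !scale1r. Qed.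

Lemma fld_trace0 : T 0 = 0.
Proof. by rewrite -(scale0r (0 : K)) fld_traceZ mul0r. Qed.

Lemma fld_traceB (x y : K) : T (x - y) = T x - T y.
Proof. by rewrite fld_traceD -scaleN1r fld_traceZ mulN1r. Qed.

Lemma fld_trace_nondegenerate (b : K) : (forall y, T (b * y) = 0) -> b = 0.
Proof.
move=> Tb; apply: contraTeq isT => b0; have [z] := @fld_trace_neq0 F K.
by rewrite -(mulVKf b0 z) Tb eqxx.
Qed.

(** Rank-nullity for the map pairing [y] with a basis of [P]. *)
Let annihilator_ge (P : {vspace K}) : exists A : {vspace K},
  (forall y, y \in A <-> {in P, forall b, T (b * y) = 0}) /\
  (n <= \dim A + \dim P)%N.
Proof.
have [|g gE] := @linear_lfun F K 'rV[F]_(\dim P)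
  (fun y => \row_i T ((vbasis P)`_i * y)).
  move=> a x y; apply/rowP => i.
  by rewrite !mxE mulrDr -scalerAr fld_traceD fld_traceZ.
exists (lker g); split=> [y|].
  rewrite memv_ker gE; split=> [/eqP Py b Pb|Py].
    rewrite (coord_vbasis Pb) mulr_suml; elim/big_rec: _ => [|i t _ Tt].
      exact: fld_trace0.
    rewrite -scalerAl fld_traceD fld_traceZ Tt addr0.
    by have /rowP/(_ i) := Py; rewrite !mxE => ->; rewrite mulr0.
  by apply/eqP/rowP => i; rewrite !mxE Py // vbasis_mem // memt_nth.
rewrite -(limg_ker_dim g fullv) capfv leq_add2l.
by apply: leq_trans (dimvS (subvf _)) _; rewrite dimvf dim_matrix mul1r.
Qed.

(** For the upper bound, let [A'] annihilate a complement of [A]. An element of both [A'] and [P]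
    pairs to zero with all of [K], so [A'] and [P] are independent, while [\dim A' >= \dim A]. *)
Lemma trace_annihilator (P : {vspace K}) : exists A : {vspace K},
  (forall y, y \in A <-> {in P, forall b, T (b * y) = 0}) /\
  (\dim A + \dim P)%N = n.
Proof.
have [A [AP leA]] := annihilator_ge P.
exists A; split=> //; apply/eqP; rewrite eqn_leq leA andbT.
have [A' [A'P]] := annihilator_ge A^C.
rewrite dimv_compl => leA'.
have AleA' : (\dim A <= \dim A')%N.
  have := dimvS (subvf A); lia.
apply: leq_trans (_ : _ <= \dim A' + \dim P)%N _; first by rewrite leq_add2r.
rewrite -dimv_disjoint_sum; first exact: dimvS (subvf _).
apply/eqP; rewrite -subv0; apply/subvP => b; rewrite memv_cap memv0 => /andP[/A'P bA' bP].
apply/eqP/fld_trace_nondegenerate => y.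
have : y \in (A + A^C)%VS by rewrite addv_complf memvf.
case/memv_addP => u /AP Au [w Aw ->].
by rewrite mulrDr fld_traceD Au // add0r mulrC bA'.
Qed.

Lemma card_trace_annihilator (P A : {vspace K}) :
  (\dim A + \dim P)%N = n ->
  #|[set y : finvect_type K | (y : K) \in A]| = (#|F| ^ (n - \dim P))%N.
Proof.
move=> <-; rewrite addnK -(@card_vspace F (finvect_type K) _ A).
by apply: eq_card => y; rewrite inE.
Qed.

End TraceForm.

Lemma vspace_of_dim (F : fieldType) (V : vectType F) (s : nat) :
  (s <= \dim {:V})%N -> exists U : {vspace V}, \dim U = s.
Proof.
move=> le_s; exists <<take s (vbasis {:V})>>%VS.
have /catl_free/eqP-> : free (take s (vbasis {:V}) ++ drop s (vbasis {:V})).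
  by rewrite cat_take_drop (basis_free (vbasisP _)).
by rewrite size_takel ?size_tuple.
Qed.

(** * Common zeros of subcodes *)

Section Code.

Variables (F : finFieldType) (K1 K2 : fieldExtType F) (Q : K1 -> F).
Hypothesis quadQ : is_quad_form Q.
Hypothesis Qneq0 : exists x, Q x != 0.
Local Notation n1 := (\dim {:K1}).
Local Notation n2 := (\dim {:K2}).
Local Notation q := #|F|.
Local Notation T := (@fld_trace F K2).
Local Notation C := (code_CQ K2 Q).
Local Notation W := (F^o * K2)%type.
Local Notation point := (finvect_type K1 * finvect_type K2)%type.

Let Q0 : Q 0 = 0.
Proof. by have [QZ _] := quadQ; rewrite -(scale0r 0) QZ expr0n mul0r. Qed.

Lemma codeword_linear : linear (fun u : W => codeword Q u.1 u.2).
Proof.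
move=> a u v; apply/rowP => j; rewrite !mxE /= !mulrDl -scalerAl fld_traceD fld_traceZ.
by rewrite mulrDr mulrA addrACA.
Qed.

Lemma codewordE (xy : point) : xy != (0, 0) ->
  exists j, forall a (b : K2), codeword Q a b 0 j = a * Q xy.1 + T (b * xy.2).
Proof.
move=> xy0; exists (enum_rank (Sub xy xy0 : coord_set K1 K2)) => a b.
by rewrite mxE enum_rankK SubK.
Qed.

(** A point [(x, 0)] with [Q x != 0] isolates [a]; the points [(0, y)] then give the trace form of
    [b]. *)
Lemma codeword_inj a (b : K2) : codeword Q a b = 0 -> a = 0 /\ b = 0.
Proof.
move=> ab0; have [x Qx] := Qneq0.
have entry0 (xy : point) : xy != (0, 0) -> a * Q xy.1 + T (b * xy.2) = 0.
  by case/codewordE => j <-; rewrite ab0 mxE.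
have a0 : a = 0.
  have := entry0 (x, 0); rewrite xpair_eqE negb_and /= mulr0 fld_trace0 addr0.
  case: (eqVneq x 0) => [x0|_ /(_ isT)/eqP]; first by rewrite x0 Q0 eqxx in Qx.
  by rewrite mulf_eq0 (negbTE Qx) orbF => /eqP.
split=> //; apply: fld_trace_nondegenerate => y.
have [->|y0] := eqVneq y 0; first by rewrite mulr0 fld_trace0.
have := entry0 (0, y); rewrite xpair_eqE negb_and /= y0 orbT a0 mul0r add0r.
exact.
Qed.

(** Parametrizes the subcodes of [C] by the subspaces of [W], preserving dimensions. *)
Lemma code_lfun : exists g : 'Hom(W, 'rV[F]_(code_len K1 K2)),
  [/\ forall a b, g (a, b) = codeword Q a b, lker g == 0%VS & limg g = C].
Proof.
have [g gE] := @linear_lfun F W 'rV[F]_(code_len K1 K2) _ codeword_linear.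
exists g; split=> [a b||]; first exact: gE.
  rewrite -subv0; apply/subvP => -[a b]; rewrite memv_ker gE /= => /eqP.
  by case/codeword_inj => -> ->; rewrite mem0v.
apply/eqP; rewrite eqEsubv; apply/andP; split.
  apply/subvP => _ /memv_imgP[[a b] _ ->]; rewrite gE /=.
  apply/memv_span/allpairsP; exists (a, b); split=> //; first by rewrite mem_enum.
  exact: (mem_enum (finvect_type K2) (b : finvect_type K2)).
apply/span_subvP => _ /allpairsP[[a b] [_ _ ->]] /=.
by rewrite -[codeword _ _ _](gE (a, b)) memv_img ?memvf.
Qed.

(** Quantifying over [finvect_type W] makes membership Boolean. The origin always belongs to this
    set, as [Q 0 = 0], though it is not a coordinate of the code. *)
Definition common_zeros (H : {vspace W}) : {set point} :=
  [set xy : point | [forall u : finvect_type W,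
    (u \in H) ==> (u.1 * Q xy.1 + T ((u.2 : K2) * xy.2) == 0)]].

Lemma common_zerosP (H : {vspace W}) (xy : point) :
  reflect (forall a (b : K2), (a, b) \in H -> a * Q xy.1 + T (b * xy.2) = 0)
          (xy \in common_zeros H).
Proof.
rewrite inE; apply: (iffP forallP) => [Hxy a b abH | Hxy [a b]].
  by apply/eqP; have /implyP/(_ abH) := Hxy (a, b).
by apply/implyP => abH; apply/eqP/Hxy.
Qed.

(** The map [pt] from positions to points misses only the origin, which is a common zero; so it
    carries the support onto the complement of the zeros. *)
Lemma card_supp_common_zeros (g : 'Hom(W, 'rV[F]_(code_len K1 K2))) (H : {vspace W}) :
  (forall a (b : K2), g (a, b) = codeword Q a b) ->
  (#|supp (g @: H)| + #|common_zeros H| = q ^ (n1 + n2))%N.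
Proof.
move=> gE.
pose pt (j : 'I_(code_len K1 K2)) : point := val (enum_val (A := mem (coord_set K1 K2)) j).
have pt_inj : injective pt by move=> i j /val_inj/enum_val_inj.
have -> : #|supp (g @: H)| = #|~: common_zeros H|.
  rewrite -(card_imset _ pt_inj); apply: eq_card => xy; rewrite in_setC.
  apply/imsetP/idP => [[j] | nz].
    rewrite inE => /existsP[v /andP[/memv_imgP[[a b] abH ->]]].
    rewrite gE mxE => nz ->; apply: contra nz => /common_zerosP/(_ a b abH) xy0.
    exact/eqP.
  have xy0 : xy != (0, 0).
    apply: contraNneq nz => ->; apply/common_zerosP => a b _ /=.
    by rewrite Q0 !mulr0 fld_trace0 addr0.
  exists (enum_rank (Sub xy xy0 : coord_set K1 K2)); last by rewrite /pt enum_rankK SubK.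
  move: nz; rewrite !inE => /forallPn[[a b]]; rewrite negb_imply => /andP[abH nz].
  apply/existsP; exists (g (a, b)); rewrite memv_img //=.
  by rewrite gE mxE enum_rankK SubK.
by rewrite addnC cardsC card_prod !card_fieldExt expnD.
Qed.
End Code.

(** * Maximal number of common zeros and the weights *)

Section CommonZeros.

Variables (F : finFieldType) (K1 K2 : fieldExtType F) (Q : K1 -> F).
Hypothesis quadQ : is_quad_form Q.
Hypothesis Qneq0 : exists x, Q x != 0.
Local Notation n1 := (\dim {:K1}).
Local Notation n2 := (\dim {:K2}).
Local Notation q := #|F|.
Local Notation T := (@fld_trace F K2).
Local Notation C := (code_CQ K2 Q).
Local Notation W := (F^o * K2)%type.
Local Notation point := (finvect_type K1 * finvect_type K2)%type.
Local Notation Z := (#|[set x : finvect_type K1 | Q x == 0]|).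

Local Notation e1 := (((1 : F^o), (0 : K2)) : W).

Lemma projection_lfun : exists f : 'Hom(W, K2), forall a b, f (a, b) = b.
Proof.
have [|f fE] := @linear_lfun F W K2 (fun u => u.2); first by [].
by exists f => a b; rewrite fE.
Qed.

Lemma mem_scalar_part (H : {vspace W}) (a : F^o) :
  a != 0 -> (a, 0) \in H -> e1 \in H.
Proof.
move=> a0 /(memvZ a^-1); congr (_ \in H).
by congr (_, _); rewrite ?scaler0 // [_ *: _]mulVf.
Qed.

Lemma card_common_zeros_scalar (H : {vspace W}) :
  e1 \in H ->
  (#|common_zeros Q H| = Z * q ^ (n2.+1 - \dim H) /\ \dim H <= n2.+1)%N.
Proof.
move=> H1; have [f fE] := projection_lfun.
pose P := (f @: H)%VS.
(* The projection to [K2] kills exactly the line of [e1], whence [n2.+1] in the exponent. *)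
have dimH : \dim H = (\dim P).+1.
  rewrite -(limg_ker_dim f H) -/P; suff -> : (H :&: lker f = <[e1]>)%VS.
    by rewrite dim_vline xpair_eqE oner_eq0.
  apply/eqP; rewrite eqEsubv; apply/andP; split; last first.
    by rewrite -memvE memv_cap H1 memv_ker fE eqxx.
  apply/subvP => -[a b]; rewrite memv_cap memv_ker fE => /andP[_ /eqP->].
  by apply/vlineP; exists a; congr (_, _); rewrite ?scaler0 // [_ *: _]mulr1.
split; last by rewrite dimH ltnS dimvS ?subvf.
have [A [AP dimA]] := trace_annihilator P.
rewrite dimH subSS -(card_trace_annihilator dimA) -cardsX.
apply: eq_card => -[x y]; rewrite in_setX; apply/common_zerosP/andP => /=.
  move=> zero; split.
    by rewrite inE; have := zero 1 0 H1; rewrite mul1r mul0r fld_trace0 addr0 => /eqP.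
  have Qx : Q x = 0 by have := zero 1 0 H1; rewrite mul1r mul0r fld_trace0 addr0.
  rewrite inE; apply/AP => b /memv_imgP[[a c] acH ->]; rewrite fE.
  by have := zero a c acH; rewrite Qx mulr0 add0r.
rewrite !inE => -[/eqP Qx /AP yP] a b abH; rewrite Qx mulr0 add0r yP //.
by rewrite -(fE a b) memv_img.
Qed.

Lemma card_common_zeros_graph (H : {vspace W}) :
  e1 \notin H ->
  (#|common_zeros Q H| <= q ^ (n1 + n2 - \dim H) /\ \dim H <= n2)%N.
Proof.
move=> H1; have [f fE] := projection_lfun.
pose P := (f @: H)%VS.
(* The projection is injective on [H]: a nonzero [(a, 0)] in [H] would put [e1] there. *)
have dimH : \dim P = \dim H.
  apply: limg_dim_eq; apply/eqP; rewrite -subv0; apply/subvP => -[a b].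
  rewrite memv_cap memv_ker fE => /andP[abH /eqP b0]; rewrite b0 in abH *.
  have [->|a0] := eqVneq a 0; first exact: mem0v.
  by rewrite (mem_scalar_part a0 abH) in H1.
have le_dim : (\dim H <= n2)%N by rewrite -dimH dimvS ?subvf.
split=> //; have [A [AP dimA]] := trace_annihilator P.
rewrite -addnBA // expnD -card_fieldExt -dimH -(card_trace_annihilator dimA).
rewrite -cardsT -cardsX.
(* [y0 x] is a chosen zero above [x]; subtracting it moves each fibre into the annihilator of [P].
   The default [0] occurs only over empty fibres. *)
pose y0 (x : finvect_type K1) : finvect_type K2 :=
  odflt 0 [pick y | (x, y) \in common_zeros Q H].
pose shift (xy : point) : point := (xy.1, xy.2 - y0 xy.1).
have shift_inj : injective shift by move=> [x y] [x' y'] [<-] /addIr <-.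
rewrite -(card_imset (common_zeros Q H) shift_inj); apply: subset_leq_card.
apply/subsetP => _ /imsetP[[x y] xyH ->]; rewrite in_setX inE /= inE.
apply/AP => b /memv_imgP[[a c] acH ->]; rewrite fE /y0.
case: pickP => [z /common_zerosP zH|/(_ y)]; last by rewrite xyH.
have /common_zerosP/(_ a c acH) /= yH := xyH.
have Tyz : T (c * y) = T (c * z) by apply: (addrI (a * Q x)); rewrite yH (zH a c acH).
by rewrite mulrBr fld_traceB Tyz subrr.
Qed.

Lemma scalar_subspace_exists (r : nat) : (0 < r <= n2.+1)%N ->
  exists2 H : {vspace W}, e1 \in H & \dim H = r.
Proof.
(* From here on [r] is the former [r - 1], the dimension of [P]. *)
case: r => // r /andP[_ ler].
have [P dimP] := vspace_of_dim ler.
have [|i iE] := @linear_lfun F K2 W (fun b => (0, b)).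
  by move=> a x y; congr (_, _); rewrite /= ?addr0 ?scaler0.
exists (<[e1]> + i @: P)%VS.
  by rewrite -[X in X \in _]addr0 memv_add ?memv_line ?mem0v.
rewrite dimv_disjoint_sum ?dim_vline ?xpair_eqE ?oner_eq0 ?limg_dim_eq ?dimP //.
  apply/eqP; rewrite -subv0; apply/subvP => b; rewrite memv_cap memv_ker iE.
  by rewrite memv0 xpair_eqE eqxx => /andP[_].
apply/eqP; rewrite -subv0; apply/subvP => u; rewrite memv_cap => /andP[/vlineP[k ->]].
case/memv_imgP => b _; rewrite iE => -[k0 _].
by rewrite [_ *: _](_ : _ = (0, 0)) ?mem0v // -k0; congr (_, _); rewrite ?scaler0.
Qed.

(** Pairs [(0, b)] put no condition on [x]; this attains the bound of [card_common_zeros_graph]. *)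
Lemma vertical_subspace_exists (r : nat) : (r <= n2)%N ->
  exists2 H : {vspace W}, \dim H = r & #|common_zeros Q H| = (q ^ (n1 + n2 - r))%N.
Proof.
move=> ler; have [P dimP] := vspace_of_dim ler.
have [|i iE] := @linear_lfun F K2 W (fun b => (0, b)).
  by move=> a x y; congr (_, _); rewrite /= ?addr0 ?scaler0.
exists (i @: P)%VS.
  rewrite limg_dim_eq //; apply/eqP; rewrite -subv0; apply/subvP => b.
  by rewrite memv_cap memv_ker iE memv0 xpair_eqE eqxx => /andP[_].
have [A [AP dimA]] := trace_annihilator P.
rewrite -addnBA // expnD -card_fieldExt -dimP -(card_trace_annihilator dimA).
rewrite -cardsT -cardsX; apply: eq_card => -[x y]; rewrite in_setX in_setT [RHS]inE /=.
apply/common_zerosP/idP => [zero|/AP yP a b /memv_imgP[c cP]].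
  apply/AP => b bP; have := zero 0 b; rewrite mul0r add0r; apply.
  by have := memv_img i bP; rewrite iE.
by rewrite iE => -[-> ->] /=; rewrite mul0r add0r yP.
Qed.

(** The support of a subcode is smallest when its zeros are most numerous. The bound on [N] keeps
    the subtraction of naturals exact. *)
Lemma is_ghw_max_zeros (r N : nat) :
  (exists2 H : {vspace W}, \dim H = r & #|common_zeros Q H| = N) ->
  (forall H : {vspace W}, \dim H = r -> #|common_zeros Q H| <= N)%N ->
  is_ghw C r (q ^ (n1 + n2) - N) /\ (N <= q ^ (n1 + n2))%N.
Proof.
have [g [gE ker0 imgE]] := code_lfun K2 quadQ Qneq0.
have suppE H := card_supp_common_zeros quadQ H gE.
move=> [H dimH cardH] maxN; split; last by rewrite -(suppE H) cardH leq_addl.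
split.
  exists (g @: H)%VS; split; first by rewrite -imgE limgS ?subvf.
    by rewrite limg_dim_eq // (eqP ker0) capv0.
  by rewrite -(suppE H) cardH addnK.
move=> K; rewrite -imgE => /lpreimK KE dimK.
rewrite -KE -(suppE (g @^-1: K)%VS) leq_subLR addnC leq_add2r; apply: maxN.
by rewrite -dimK -[in RHS]KE limg_dim_eq // (eqP ker0) capv0.
Qed.

(** [NA] belongs to the subspaces containing [e1]; the competing value comes from the others, which
    exist only for [r <= n2]. *)
Lemma is_ghw_code (r : nat) : (0 < r <= n2.+1)%N ->
  let NA := (Z * q ^ (n2.+1 - r))%N in
  let N := if (r <= n2)%N then maxn NA (q ^ (n1 + n2 - r)) else NA in
  is_ghw C r (q ^ (n1 + n2) - N) /\ (N <= q ^ (n1 + n2))%N.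
Proof.
move=> r_bounds NA N; have [HA HA1 dimHA] := scalar_subspace_exists r_bounds.
have [cardHA _] := card_common_zeros_scalar HA1.
apply: is_ghw_max_zeros => [|H dimH].
  rewrite /N; case: ifP => [ler|_]; last by exists HA; rewrite // cardHA dimHA.
  rewrite /maxn; case: ifP => _; first exact: vertical_subspace_exists.
  by exists HA; rewrite // cardHA dimHA.
have [H1|H1] := boolP (e1 \in H).
  have [-> _] := card_common_zeros_scalar H1; rewrite dimH -/NA /N.
  by case: ifP; rewrite ?leq_maxl.
have [le_card le_dim] := card_common_zeros_graph H1; rewrite dimH in le_card le_dim.
by rewrite /N le_dim; apply: leq_trans le_card _; apply: leq_maxr.
Qed.

End CommonZeros.

(** Here [x] is [q], [z] the number of zeros of [Q], [s] its rank, [h] half of it and [e] the sign.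
    Writing [x ^+ s * x ^- h] lets [e = h = 0] cover odd rank. *)
Lemma rescale_zero_count (x z e : rat) (n1 n2 r s h : nat) :
  x != 0 -> (0 < n1)%N -> (s <= n1)%N -> (r <= n2.+1)%N ->
  z * x = x ^+ (n1 - s) * (x ^+ s + x ^+ s * x ^- h * e * (x - 1)) ->
  z * x ^+ (n2.+1 - r) = x ^+ (n1 + n2 - r) * (1 + e * (x - 1) * x ^- h).
Proof.
move=> x0 n1_gt0 les ler zx; apply: (mulIf x0); rewrite mulrAC zx.
rewrite [RHS]mulrAC -exprSr (_ : (n1 + n2 - r).+1 = (n2.+1 - r) + (n1 - s) + s)%N; last lia.
by rewrite !exprD; ring.
Qed.

Theorem theorem2 (p m m1 m2 : nat) (F : finFieldType) (K1 K2 : fieldExtType F)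
    (Q : K1 -> F) :
  prime p -> odd p -> (0 < m)%N -> #|F| = (p ^ m)%N ->
  (0 < m1)%N -> (0 < m2)%N -> \dim {:K1} = m1 -> \dim {:K2} = m2 ->
  is_quad_form Q -> (exists x : K1, Q x != 0) ->
  let q : rat := (p ^ m)%N%:R in
  let M := (m1 + m2)%N in
  let rQ := qf_rank Q in
  let C := code_CQ K2 Q in
  forall r : nat, (1 <= r <= m2.+1)%N ->
    [/\ (~~ odd rQ -> qf_epsilon_is p m Q 1 ->
           exists d : nat, is_ghw C r d /\
             d%:R = q ^+ (M - r) * (q ^+ r - 1 - (q - 1) * q ^- (rQ %/ 2))),
        (~~ odd rQ -> qf_epsilon_is p m Q (-1) -> (r < m2.+1)%N ->
           exists d : nat, is_ghw C r d /\ d%:R = q ^+ (M - r) * (q ^+ r - 1)),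
        (~~ odd rQ -> qf_epsilon_is p m Q (-1) -> r = m2.+1 ->
           exists d : nat, is_ghw C r d /\
             d%:R = q ^+ (M - r) * (q ^+ r - 1 + (q - 1) * q ^- (rQ %/ 2))) &
        (odd rQ ->
           exists d : nat, is_ghw C r d /\ d%:R = q ^+ (M - r) * (q ^+ r - 1))].
Proof.
move=> pr_p odd_p m_gt0 cardF m1_gt0 m2_gt0 dim1 dim2 quadQ Qneq0 q M rQ C r r_bounds.
have two_neq0 : (2%:R : F) != 0.
  have pF := card_finPcharP cardF pr_p; apply/negP => two0.
  have : 2%N \in [pchar F] by rewrite inE /= two0.
  by rewrite (pcharf_eq pF) inE => /eqP p2; rewrite -p2 in odd_p.
have q_gt1 : 1 < q by rewrite /q -cardF -[1]/(1%:R) ltr_nat finNzRing_gt1.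
have q_gt0 : 0 < q := lt_trans ltr01 q_gt1.
have q_neq0 : q != 0 := lt0r_neq0 q_gt0.
have ler : (r <= m2.+1)%N by case/andP: r_bounds.
have rQ_le : (rQ <= m1)%N by rewrite -dim1 qf_rank_le.
have := @is_ghw_code F K1 K2 Q quadQ Qneq0 r; rewrite dim1 dim2 cardF.
move=> /(_ r_bounds); set Z := #|_|; set NA := (Z * _)%N => /=.
set B := (_ ^ (m1 + m2 - r))%N => ghw.
have BE : B%:R = q ^+ (M - r) by rewrite /B natrX.
(* [e] is the relative excess of the maximal zero count over [q ^+ (M - r)]. *)
have ghw_value N (e : rat) : is_ghw C r ((p ^ m) ^ M - N) /\ (N <= (p ^ m) ^ M)%N ->
    N%:R = q ^+ (M - r) * (1 + e) ->
    exists d : nat, is_ghw C r d /\ d%:R = q ^+ (M - r) * (q ^+ r - 1 - e).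
  move=> [ghwN leN] NE; exists ((p ^ m) ^ M - N)%N; split=> //.
  rewrite natrB // NE natrX -/q -[in LHS](@subnK r M); last by rewrite /M; lia.
  by rewrite exprD addnK; ring.
have NAE e h : Z%:R * q = q ^+ (m1 - rQ) * (q ^+ rQ + q ^+ rQ * q ^- h * e * (q - 1)) ->
    NA%:R = q ^+ (M - r) * (1 + e * (q - 1) * q ^- h).
  by move=> ZE; rewrite /NA natrM natrX; apply: rescale_zero_count ZE.
have evenE (eps : int) : ~~ odd rQ -> qf_epsilon_is p m Q eps ->
    NA%:R = q ^+ (M - r) * (1 + eps%:~R * (q - 1) * q ^- (rQ %/ 2)).
  move=> even_r epsE; apply: NAE; rewrite divn2.
  have := card_roots_epsilon two_neq0 odd_p cardF even_r epsE.
  rewrite dim1 cardF -/Z => /(congr1 (fun t : int => t%:~R : rat)).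
  have qE : q = p%:R ^+ m by rewrite /q natrX.
  rewrite !(rmorphM, rmorphD, rmorphXn, rmorphN, rmorph1, rmorph_nat) /= -qE => ->.
  have -> : q ^+ rQ * q ^- rQ./2 = q ^+ rQ./2.
    by rewrite -{1}[rQ]odd_double_half (negbTE even_r) add0n -addnn exprD mulfK ?expf_neq0.
  by [].
have e_gt0 : 0 <= (q - 1) * q ^- (rQ %/ 2).
  by rewrite mulr_ge0 ?subr_ge0 ?invr_ge0 ?exprn_ge0 // ltW.
have qM_gt0 : 0 < q ^+ (M - r) by rewrite exprn_gt0.
split.
- move=> even_r epsE; have := evenE _ even_r epsE; rewrite mul1r => NAe.
  (* For sign 1 the excess is nonnegative, so [NA] is the maximum. *)
  apply: (ghw_value _ _ _ NAe); have le_B : (B <= NA)%N.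
    by rewrite -(ler_nat rat) NAe BE ler_pMr // lerDl.
  by move: ghw; case: ifP => // _; rewrite (maxn_idPl le_B).
- move=> even_r epsE lt_r; have := evenE _ even_r epsE; rewrite mulN1r mulNr => NAe.
  rewrite -[q ^+ r - 1]subr0; apply: (@ghw_value B); last by rewrite addr0 mulr1.
  (* For sign -1 the excess is at most 0, and [B] wins as long as [r <= m2]. *)
  have le_B : (NA <= B)%N by rewrite -(ler_nat rat) NAe BE ler_piMr ?(ltW qM_gt0) // gerBl.
  by move: ghw; rewrite -ltnS lt_r (maxn_idPr le_B).
- move=> even_r epsE r_eq; have := evenE _ even_r epsE; rewrite mulN1r mulNr => NAe.
  rewrite -[(q - 1) * _]opprK; apply: (ghw_value _ _ _ NAe).
  (* In dimension [m2.+1] every subspace contains [e1], so only [NA] is left. *)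
  by move: ghw; rewrite r_eq ltnn.
- move=> odd_r; have ZE := card_roots_odd_rank two_neq0 quadQ odd_r.
  (* Odd rank has excess 0: [NA] and [B] coincide. *)
  have NAe : NA%:R = q ^+ (M - r) * (1 + 0).
    rewrite (NAE 0 0%N) ?mul0r //; rewrite mulr0 mul0r addr0 -exprD subnK //.
    by rewrite -natrM -natrX -dim1 -cardF -ZE.
  rewrite -[q ^+ r - 1]subr0; apply: (ghw_value _ _ _ NAe).
  have le_B : (B <= NA)%N by rewrite -(ler_nat rat) NAe BE addr0 mulr1.
  by move: ghw; case: ifP => // _; rewrite (maxn_idPl le_B).
Qed.
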